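(* Let $V$ be a finite-dimensional vector space over $\Bbbk$ with a symmetric bilinear form, let $R\subseteq V\setminus\{0\}$ be a finite irreducible generalized reflection root system (GRRS), and let $\theta:V\to V$ be a linear automorphism preserving the form with $\theta(R)=R$. Let $S=\{\alpha\in R:\theta(\alpha)=\alpha\}$. Let $T\subseteq S$ be the smallest subset of $S$ containing all odd roots of $S$ and such that if $\alpha\in T$, $\beta\in S$ with $(\alpha,\beta)\neq 0$, then $\beta\in T$. Then one of the following holds: (1) $T=\emptyset$; (2) $T=\{\pm\alpha\}$ for an isotropic root $\alpha$; (3) $T\subseteq\operatorname{span}(T)$ is a finite irreducible GRRS containing at least one odd root.
   Context: $\Bbbk$ is an algebraically closed field of characteristic zero. Let $V$ be a finite-dimensional $\Bbbk$-vector space with a symmetric bilinear form $(\cdot,\cdot)$, not necessarily nondegenerate. A finite GRRS in $V$ is a nonempty finite set $R\subseteq V\setminus\{0\}$ (elements called roots) such that: (i) $\operatorname{span}(R)=V$; (ii) for each $\alpha\in R$, $(\alpha,-)\neq0$ in $V^*$; (iii) for $\alpha,\beta\in R$ with $(\alpha,\alpha)\neq0$, $k_{\alpha,\beta}:=\frac{2(\alpha,\beta)}{(\alpha,\alpha)}\in\mathbb{Z}$ and $r_\alpha(\beta):=\beta-k_{\alpha,\beta}\alpha\in R$; (iv) for $\alpha\in R$ with $(\alpha,\alpha)=0$ there is a bijection $r_\alpha:R\to R$ with $r_\alpha(\beta)=\beta$ if $(\alpha,\beta)=0$ and $r_\alpha(\beta)=\beta\pm\alpha$ if $(\alpha,\beta)\neq0$;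 (v) $R=-R$. For a subset $T\subseteq R$, saying that $T\subseteq\operatorname{span}(T)$ is a GRRS means with respect to the restricted form on $\operatorname{span}(T)$. $R$ is reducible if $R=R'\sqcup R''$ with $R',R''$ nonempty and mutually orthogonal; otherwise it is irreducible. $R_{re}=\{\alpha\in R:(\alpha,\alpha)\neq0\}$ is the set of real roots and $R_{im}=\{\alpha\in R:(\alpha,\alpha)=0\}$ the set of imaginary (isotropic) roots. A root $\alpha$ is odd if $\alpha\in R_{im}$ or $2\alpha\in R_{re}$; otherwise it is even. *)

(* Defs.v *)
From mathcomp Require Export all_boot all_algebra.
From mathcomp Require Export finmap.

Set Implicit Arguments.
Unset Strict Implicit.
Unset Printing Implicit Defensive.

Import GRing.Theory.
Local Open Scope fset_scope.
Local Open Scope ring_scope.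

Section GRRS.

Variables (k : fieldType) (V : vectType k) (f : {symmetric V}).

Definition real_root (R : {fset V}) (a : V) : bool :=
  (a \in R) && (f a a != 0).

Definition imaginary_root (R : {fset V}) (a : V) : bool :=
  (a \in R) && (f a a == 0).

Definition odd_root (R : {fset V}) (a : V) : bool :=
  (a \in R) && (imaginary_root R a || real_root R (2 *: a)).

Definition kcoef (a b : V) : k := 2 * f a b / f a a.

Definition reflection (a b : V) : V := b - kcoef a b *: a.

(* R is a finite GRRS in the subspace U for the restriction of f to U; the
   ambient case is U = fullv. Since <<R>> = U, all roots lie in U. *)
Record grrs_in (U : {vspace V}) (R : {fset V}) : Prop := GrrsIn {
  grrs_nonempty : R != fset0;
  grrs_nonzero : 0 \notin R;
  grrs_span : <<R>>%VS = U;
  grrs_nondeg : forall a, a \in R -> exists2 v, v \in U & f a v != 0;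
  grrs_real : forall a b, real_root R a -> b \in R ->
    (exists z : int, kcoef a b = z%:~R) /\ reflection a b \in R;
  grrs_imaginary : forall a, imaginary_root R a ->
    exists r : R -> R, bijective r /\
      forall b : R,
        (f a (val b) = 0 -> val (r b) = val b) /\
        (f a (val b) != 0 -> val (r b) = val b + a \/ val (r b) = val b - a);
  grrs_opp : R = [fset - a | a in R]
}.

Definition reducible_roots (R : {fset V}) : Prop :=
  exists R1 R2 : {fset V},
    [/\ R1 != fset0, R2 != fset0, [disjoint R1 & R2], R = R1 `|` R2
      & forall a b, a \in R1 -> b \in R2 -> f a b = 0].

Definition irreducible_grrs_in (U : {vspace V}) (R : {fset V}) : Prop :=
  grrs_in U R /\ ~ reducible_roots R.

Definition fixed_roots (theta : V -> V) (R : {fset V}) : {fset V} :=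
  [fset a in R | theta a == a].

(* Oddness of the elements of S is that of roots of R. *)
Definition odd_closed (R S T : {fset V}) : Prop :=
  [/\ T `<=` S,
      forall a, a \in S -> odd_root R a -> a \in T
    & forall a b, a \in T -> b \in S -> f a b != 0 -> b \in T].

Definition smallest_odd_closed (R S T : {fset V}) : Prop :=
  odd_closed R S T /\ forall T', odd_closed R S T' -> T `<=` T'.

End GRRS.

(* Main.v *)
Require Import Defs.
From mathcomp Require Import all_boot all_algebra.
From mathcomp Require Import finmap.
From mathcomp Require Import ring zify.

Import GRing.Theory.
Local Open Scope fset_scope.
Local Open Scope ring_scope.

(** The theorem says that the odd roots fixed by theta, together with whatever
    the non-orthogonality graph of S attaches to them, form one connected
    piece; everything else in it is formal. Closing a set of fixed roots under
    non-orthogonality keeps it stable under its own reflections, because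
    reflecting b in a changes b by a multiple of a and at most the sign of
    (a, b), so [T] inherits the GRRS axioms from [R] unless an isotropic root
    of [T] has nothing to pair with. Minimality of [T] then turns
    irreducibility of [T] into the statement that any two odd roots of S are
    joined inside S.

    So let a and b be orthogonal odd roots of [R] with b different from a and
    -a. Irreducibility of [R] gives a common neighbour of a and b in [R]:
    sliding one root of a path along the next shortens every longer path
    ([common_neighbor]). The point is that a common neighbour x can be chosen
    so that a and b determine it, so that theta must fix it when it fixes a
    and b ([odd_roots_linked]).

    - If 2a and 2b are roots, integrality leaves x = a + b, up to the signs of
      a and b ([real_odd_linked]).
    - Otherwise, up to signs, a + b = x + y with x and y orthogonal real roots
      whose norms have a negative rational ratio, as in
      (e1 - d1) - (e2 - d2) = (e1 - e2) - (d1 - d2) for gl(m|n)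
      ([isotropic_linked], [real_odd_isotropic_linked]). Such a decomposition
      is unique: if theta fixes x + y then x' = theta x has the norm of x and
      (x', x) + (x', y) = (x, x). Two real roots of opposite norms would
      generate an infinite dihedral orbit unless they are orthogonal
      ([opposite_norm_orth]), so (x', y) = 0 and (x', x) = (x, x) = (x', x').
      If x' differed from x, the product of their reflections would be a
      non-trivial unipotent map and its orbit in [R] infinite
      ([eq_of_equal_form_values]). Hence x' = x ([rigid_summand]).

    No classification of GRRSs enters: the remaining numerical information
    comes from the bound 0 <= pq <= 4 on the two Cartan integers
    of a pair of real roots ([real_root_pair_bound]) and from the possible
    pairings of a real root with an isotropic one
    ([isotropic_root_string]). *)

(** * Arithmetic *)

(** One round of reflections multiplies both Cartan integers p and q of a pair
    of real roots by 3 - pq. Outside the range 0 <= pq <= 4 this factor has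
    absolute value at least 2 and the product stays outside the range, so p
    grows without bound. *)
Lemma string_product_growth (p q : int) : ~~ (0 <= p * q <= 4) ->
  (absz p < absz (p * (3 - p * q))%R)%N /\
  ~~ (0 <= p * (3 - p * q) * (q * (3 - p * q)) <= 4).
Proof.
move=> bad; split.
  have p0 : (0 < absz p)%N.
    by rewrite absz_gt0; apply: contraNneq bad => ->; rewrite mul0r.
  have : (1 < absz (3 - p * q)%R)%N by move: (p * q) bad => m; clear; lia.
  by rewrite abszM => d2; rewrite -[X in (X < _)%N]muln1 ltn_pmul2l.
have -> : p * (3 - p * q) * (q * (3 - p * q)) = p * q * (3 - p * q) ^+ 2.
  by ring.
move: (p * q) bad => m bad {p q}.
have [m_lt0 | m_ge5] : m < 0 \/ 5 <= m by lia.
  have: 1 <= (3 - m) ^+ 2 by rewrite expr2; nia.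
  by move: ((3 - m) ^+ 2) => s; nia.
have: 4 <= (3 - m) ^+ 2 by rewrite expr2; nia.
by move: ((3 - m) ^+ 2) => s; nia.
Qed.

Lemma small_string_products (z p : int) : z != 0 -> p != 0 ->
  0 <= 2 * z * p <= 4 -> exists2 s : int, s = 1 \/ s = -1 &
  [\/ z = s /\ p = s, z = s /\ p = 2 * s | z = 2 * s /\ p = s].
Proof.
move=> z0 p0 /andP[lo hi]; have zp : 0 < z * p.
  have := mulf_neq0 z0 p0; rewrite -mulrA in lo.
  by move: (z * p) lo => m; clear; lia.
have zp2 : (absz z * absz p <= 2)%N.
  rewrite -abszM; rewrite -mulrA in hi.
  by move: (z * p) zp hi => m; clear; lia.
have zle : (absz z <= 2)%N.
  by apply: leq_trans zp2; rewrite leq_pmulr // absz_gt0.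
have ple : (absz p <= 2)%N.
  by apply: leq_trans zp2; rewrite leq_pmull // absz_gt0.
have [z_pos|z_neg] : 0 < z \/ z < 0 by lia.
  exists 1; first by left.
  have [[-> ->]|[[-> ->]|[-> ->]]] :
    z = 1 /\ p = 1 \/ z = 1 /\ p = 2 \/ z = 2 /\ p = 1 by nia.
  - by constructor 1.
  - by constructor 2.
  - by constructor 3.
exists (-1); first by right.
have [[-> ->]|[[-> ->]|[-> ->]]] :
  z = -1 /\ p = -1 \/ z = -1 /\ p = -2 \/ z = -2 /\ p = -1 by nia.
- by constructor 1.
- by constructor 2.
- by constructor 3.
Qed.

Section CharacteristicZero.

Set Implicit Arguments.
Unset Strict Implicit.

Variables (k : fieldType) (char0 : [pchar k] =i pred0).

Lemma natr_neq0 n : (n.+1%:R : k) != 0.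
Proof. by rewrite ((pcharf0P k).1 char0). Qed.

Lemma intr_eq0_char0 (z : int) : ((z%:~R : k) == 0) = (z == 0).
Proof.
case: z => n; first by rewrite -pmulrn ((pcharf0P k).1 char0).
by rewrite NegzE mulrNz oppr_eq0 -pmulrn ((pcharf0P k).1 char0).
Qed.

Lemma intr_inj_char0 : injective (fun z : int => z%:~R : k).
Proof.
move=> p q /eqP; rewrite -subr_eq0 -rmorphB /= intr_eq0_char0 subr_eq0.
by move/eqP.
Qed.

Lemma intr_mulI (c : k) (p q : int) : c != 0 -> p%:~R * c = q%:~R * c -> p = q.
Proof. by move=> c0 /(mulIf c0) /intr_inj_char0. Qed.

End CharacteristicZero.

(** * Symmetric bilinear forms *)

Section SymmetricForm.

Set Implicit Arguments.
Unset Strict Implicit.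

Variables (k : fieldType) (V : vectType k) (f : {symmetric V}).

Lemma formC u v : f u v = f v u.
Proof. by rewrite (hermC f) expr0 mul1r. Qed.

Lemma formDl u v w : f (u + v) w = f u w + f v w.
Proof. exact: linearDl. Qed.

Lemma formDr u v w : f w (u + v) = f w u + f w v.
Proof. exact: linearDr. Qed.

Lemma formNl u w : f (- u) w = - f u w.
Proof. exact: linearNl. Qed.

Lemma formNr u w : f w (- u) = - f w u.
Proof. exact: linearNr. Qed.

Lemma formZl c u w : f (c *: u) w = c * f u w.
Proof. exact: linearZl_LR. Qed.

Lemma formZr c u w : f w (c *: u) = c * f w u.
Proof. by rewrite formC formZl formC. Qed.

Definition formE := (formDl, formDr, formNl, formNr, formZl, formZr).

Lemma form_sqrD u v : f (u + v) (u + v) = f u u + 2 * f u v + f v v.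
Proof. by rewrite !formE (formC v u); ring. Qed.

Lemma form_sqrB u v : f (u - v) (u - v) = f u u - 2 * f u v + f v v.
Proof. by rewrite !formE (formC v u); ring. Qed.

Lemma reflection_norm a b c : 2 * f a b = c * f a a ->
  f (b - c *: a) (b - c *: a) = f b b.
Proof. by move=> /esym e; rewrite !formE (formC b a); ring: e. Qed.

End SymmetricForm.

(** * Pairs of roots in a finite GRRS *)

Section RootStrings.

Set Implicit Arguments.
Unset Strict Implicit.

Variables (k : fieldType) (char0 : [pchar k] =i pred0).
Variables (V : vectType k) (f : {symmetric V}).
Variables (U : {vspace V}) (R : {fset V}) (G : grrs_in f U R).

Let two0 : (2 : k) != 0 := natr_neq0 char0 1.

Lemma rootN a : a \in R -> - a \in R.
Proof. by move=> aR; rewrite (grrs_opp G); apply/imfsetP; exists a. Qed.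

(** [kcoef] with its denominator cleared: the form in which integrality and
    reflections are used below. *)
Lemma real_root_int a b : a \in R -> f a a != 0 -> b \in R ->
  exists2 z : int, 2 * f a b = z%:~R * f a a & b - z%:~R *: a \in R.
Proof.
move=> aR a0 bR; have ra : real_root f R a by rewrite /real_root aR a0.
have [[z ez] rR] := grrs_real G ra bR.
exists z; last by rewrite -ez.
by rewrite -ez /kcoef mulfVK.
Qed.

Lemma imaginary_root_shift a b :
  a \in R -> f a a = 0 -> b \in R -> f a b != 0 ->
  b + a \in R \/ b - a \in R.
Proof.
move=> aR a0 bR ab.
have ia : imaginary_root f R a by rewrite /imaginary_root aR a0 eqxx.
have [r [_ /(_ [` bR])[_ /(_ ab)]]] := grrs_imaginary G ia.
by case=> /= <-; [left | right]; apply: valP.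
Qed.

(** Unbounded sequences of Cartan integers contradict finiteness of [R] through
    this bound. *)
Lemma kcoef_bounded x : x \in R -> f x x != 0 ->
  exists B : nat, forall z (p : int),
    z \in R -> 2 * f x z = p%:~R * f x x -> (absz p <= B)%N.
Proof.
move=> xR x0.
suff [B HB] : exists B : nat, forall z (p : int),
    z \in (R : seq V) -> 2 * f x z = p%:~R * f x x -> (absz p <= B)%N.
  by exists B.
have: {subset (R : seq V) <= R} by [].
elim: (R : seq V) => [|z s IHs] sR; first by exists 0%N.
have [|B HB] := IHs; first by move=> y ys; apply: sR; rewrite inE ys orbT.
have [|q eq _] := real_root_int xR x0 (b := z).
  by apply: sR; rewrite inE eqxx.
exists (maxn B (absz q)) => y p; rewrite inE => /orP[/eqP-> | ys] ep.
  rewrite eq in ep; rewrite (intr_mulI char0 x0 ep).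
  exact: leq_maxr.
by apply: leq_trans (leq_maxl _ _); apply: HB ep.
Qed.

(** In a finite root system the product of the two Cartan integers of a pair
    of roots is 4 cos^2 of an angle. There is no positivity here, and the bound
    comes from finiteness: with w = r_z(x), the root r_w(z) has the norm of z
    and its Cartan integers with x are those of z multiplied by 3 - pq. Outside
    the range these integers would take infinitely many values. *)
Lemma real_root_pair_bound x y (p q : int) :
  x \in R -> y \in R -> f x x != 0 -> f y y != 0 ->
  2 * f x y = p%:~R * f x x -> 2 * f x y = q%:~R * f y y ->
  0 <= p * q <= 4.
Proof.
move=> xR yR x0 y0 ep eq; apply/negPn/negP => bad.
have [B HB] := kcoef_bounded xR x0.
suff /(_ B.+1)[z [p' [q' [[zR _ ep' _ _] ge]]]] : forall n : nat,
    exists z (p' q' : int),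
    [/\ z \in R, f z z = f y y, 2 * f x z = p'%:~R * f x x,
        2 * f x z = q'%:~R * f y y & ~~ (0 <= p' * q' <= 4)]
    /\ (n <= absz p')%N.
  by have := HB _ _ zR ep'; rewrite leqNgt ge.
elim=> [|n [z [p' [q' [[zR zz ep' eq' bad'] np]]]]].
  by exists y, p, q.
have xz0 : f z z != 0 by rewrite zz.
have [q1 eq1 wR] := real_root_int zR xz0 xR.
have Eq1 : q1 = q'.
  by apply: (intr_mulI char0 xz0); rewrite -eq1 zz -eq' formC.
rewrite {q1 eq1}Eq1 in wR.
set w := _ - _ in wR.
have ehp : p'%:~R * f x x = 2 * f x z by rewrite ep'.
have ehq : q'%:~R * f z z = 2 * f x z by rewrite zz eq'.
have ww : f w w = f x x by apply: reflection_norm; rewrite ehq formC.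
have wz : 2 * f w z = (- p')%:~R * f w w.
  by rewrite ww /w !formE; ring: ehp ehq.
have w0 : f w w != 0 by rewrite ww.
have [r er tR] := real_root_int wR w0 zR.
have Er : r = - p' by apply: (intr_mulI char0 w0); rewrite -er -wz.
rewrite {r er}Er in tR.
exists (z - (- p')%:~R *: w), (p' * (3 - p' * q')), (q' * (3 - p' * q')).
move: wz; rewrite ww => wz.
have xt : 2 * f x (z - (- p')%:~R *: w) = (p' * (3 - p' * q'))%:~R * f x x.
  by rewrite /w !formE; ring: ehp.
have [grow bad''] := string_product_growth _ _ bad'.
split; last exact: leq_ltn_trans np grow.
split=> //.
- by rewrite -zz; apply: reflection_norm; rewrite wz ww.
- rewrite xt -zz; ring: ehp ehq.
Qed.

Lemma reflect_mem a b (z : int) : a \in R -> f a a != 0 -> b \in R ->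
  2 * f a b = z%:~R * f a a -> b - z%:~R *: a \in R.
Proof.
move=> aR a0 bR ez; have [y ey] := real_root_int aR a0 bR.
by have -> : y = z by apply: (intr_mulI char0 a0); rewrite -ey ez.
Qed.

(** Write y = x + u. Then u is orthogonal to x and to itself, so -r_x sends
    x + cu to x - cu and -r_y sends x - cu to x + (c + 2)u: the set [R] would
    contain all x + 2nu, which are distinct in characteristic zero unless u
    vanishes. *)
Lemma eq_of_equal_form_values x y : x \in R -> y \in R -> f x x != 0 ->
  f y y = f x x -> f x y = f x x -> x = y.
Proof.
move=> xR yR x0 yy xy; have [u yE] : exists u, y = x + u.
  by exists (y - x); rewrite addrC subrK.
rewrite {y}yE in yR yy xy *; apply/eqP; rewrite -subr_eq0 opprD addrA subrr.
rewrite sub0r oppr_eq0; apply/negPn/negP => u0.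
have xu : f x u = 0 by apply: (addrI (f x x)); rewrite addr0 -formDr.
have uu : f u u = 0.
  by move: yy; rewrite !formE (formC f u x) xu !addr0 add0r => /eqP;
     rewrite addrC -subr_eq0 addrK => /eqP.
have memR (n : nat) : x + n.*2%:R *: u \in R.
  elim: n => [|n IHn]; first by rewrite scale0r addr0.
  have e1 : 2 * f x (x + n.*2%:R *: u) = (2 : int)%:~R * f x x.
    by rewrite !formE xu mulr0 addr0.
  have /rootN := reflect_mem xR x0 IHn e1.
  have -> : - (x + n.*2%:R *: u - (2 : int)%:~R *: x) = x - n.*2%:R *: u.
    rewrite -[(2 : int)%:~R]/(2%:R) (scaler_nat 2 x) mulr2n.
    by rewrite !opprD !opprK addrC addrACA subrr add0r.
  move=> mR; have y0 : f (x + u) (x + u) != 0 by rewrite yy.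
  have e2 : 2 * f (x + u) (x - n.*2%:R *: u)
      = (2 : int)%:~R * f (x + u) (x + u).
    by rewrite yy !formE (formC f u x) xu uu !mulr0 !subr0 addr0.
  have /rootN := reflect_mem yR y0 mR e2; congr (_ \in R).
  rewrite -[(2 : int)%:~R]/(2%:R) (scaler_nat 2 (x + u)) doubleS.
  rewrite -[n.*2.+2]addn2 natrD scalerDl (scaler_nat 2 u) !mulr2n.
  rewrite !opprD !opprK addrC (addrACA x u) (addrACA (x + x)) addrK.
  by rewrite [u + u + _]addrC.
have inj : injective (fun n : nat => x + n.*2%:R *: u).
  move=> m n /addrI /eqP; rewrite -subr_eq0 -scalerBl scaler_eq0.
  rewrite (negPf u0) orbF.
  rewrite -[m.*2%:R]/((m.*2 : int)%:~R) -[n.*2%:R]/((n.*2 : int)%:~R) -rmorphB.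
  by rewrite /= intr_eq0_char0 // subr_eq0 => /eqP[] /double_inj.
pose translates := [seq x + n.*2%:R *: u | n <- iota 0 (size R).+1].
have : (size translates <= size R)%N.
  rewrite /translates; apply: uniq_leq_size.
    by rewrite (map_inj_uniq inj) iota_uniq.
  by move=> v /mapP[n _ ->]; apply: memR.
by rewrite /translates size_map size_iota ltnn.
Qed.

(** The Cartan integers satisfy q = -(n + 1)p, so their product is negative
    unless both vanish. *)
Lemma opposite_norm_orth x y (n : nat) : x \in R -> y \in R -> f x x != 0 ->
  f x x = - (f y y *+ n.+1) -> f x y = 0.
Proof.
move=> xR yR x0 e.
have y0 : f y y != 0.
  by apply: contraNneq x0 => y0; rewrite e y0 mul0rn oppr0.
have [p ep _] := real_root_int xR x0 yR.
have [q eq _] := real_root_int yR y0 xR; rewrite formC in eq.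
have pq := real_root_pair_bound xR yR x0 y0 ep eq.
have qp : q = - (p * n.+1%:Z).
  apply: (intr_mulI char0 y0); rewrite -eq ep e -mulr_natr rmorphN rmorphM /=.
  by rewrite -pmulrn; ring.
have p0 : p = 0.
  move: pq; rewrite {}qp => /andP[+ _]; clear; nia.
by apply/(mulfI two0); rewrite ep p0 mul0r mulr0.
Qed.

(** Uniqueness of the decomposition of x + y into a summand with the norm of x
    and a remainder: x' is orthogonal to y because their norms are opposite up
    to a positive rational, whence (x', x) = (x, x). *)
Lemma rigid_summand x y x' (n : nat) : x \in R -> y \in R -> x' \in R ->
  f x x != 0 -> f x y = 0 -> f x x = - (f y y *+ n.+1) ->
  f x' x' = f x x -> f x' (x + y) = f x x -> x' = x.
Proof.
move=> xR yR x'R x0 xy e xx'; have x'0 : f x' x' != 0 by rewrite xx'.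
rewrite formE (@opposite_norm_orth x' y n) ?addr0 ?xx' // => x'x.
by apply: eq_of_equal_form_values; rewrite ?xx'.
Qed.

(** Let c = 2(g, a)/(g, g), with the sign of a chosen so that g - a is a root;
    its norm is (1 - c)(g, g). Either c = 1 and g - a is isotropic, or g - a is
    real and integrality of its pairing with g says that 1 - c divides 1, that
    is c = 2. *)
Lemma isotropic_root_string g a :
  g \in R -> f g g != 0 -> a \in R -> f a a = 0 ->
  f g a != 0 -> exists a', [/\ a' = a \/ a' = - a, g - a' \in R
    & 2 * f g a' = f g g \/ f g a' = f g g].
Proof.
move=> gR g0 aR a0 ga.
wlog bR : a aR a0 ga / g - a \in R.
  move=> H; have ag : f a g != 0 by rewrite formC.
  case: (imaginary_root_shift aR a0 gR ag) => bR; last exact: (H a).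
  have [||||a' [ha' h1 h2]] := H (- a);
    rewrite ?rootN ?formE ?a0 ?oppr0 ?opprK //.
    by rewrite oppr_eq0.
  exists a'; split=> //; case: ha' => ->; rewrite ?opprK; by [left | right].
exists a; split=> //; first by left.
have [c ec _] := real_root_int gR g0 aR.
have c0 : c != 0.
  apply: contraNneq ga => c0; apply/eqP/(mulfI two0).
  by rewrite ec c0 mul0r mulr0.
have nb : f (g - a) (g - a) = (1 - c)%:~R * f g g.
  by rewrite !formE a0 (formC f a g); ring: (esym ec).
have [b0|b0] := eqVneq (f (g - a) (g - a)) 0.
  left; rewrite ec; move/eqP: b0; rewrite nb mulf_eq0 (negPf g0) orbF.
  by rewrite intr_eq0_char0 // subr_eq0 => /eqP <-; rewrite mul1r.
right; have [z ez _] := real_root_int bR b0 gR.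
have : (z - 1) * (1 - c) = 1.
  apply: (intr_mulI char0 g0); rewrite mul1r rmorphM /= rmorphB /= mulrBl mul1r.
  rewrite mulrBl -mulrA -nb -ez nb !formE (formC f a g); ring: (esym ec).
move=> /(congr1 absz)/eqP; rewrite abszM muln_eq1 => /andP[_ /eqP c1].
have c2 : c = 2 by move: c0 c1; clear; lia.
by apply: (mulfI two0); rewrite ec c2.
Qed.

End RootStrings.

(** * Common neighbours of orthogonal odd roots *)

Section CommonNeighbors.

Set Implicit Arguments.
Unset Strict Implicit.

Variables (k : fieldType) (char0 : [pchar k] =i pred0).
Variables (V : vectType k) (f : {symmetric V}).
Variables (U : {vspace V}) (R : {fset V}) (G : grrs_in f U R).
Hypothesis irr : ~ reducible_roots f R.

Let two0 : (2 : k) != 0 := natr_neq0 char0 1.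

(** A root orthogonal to all roots would be orthogonal to their span. *)
Lemma neighbor_exists a : a \in R -> exists2 c, c \in R & f a c != 0.
Proof.
move=> aR; have [v vU av] := grrs_nondeg G aR.
case: (boolP (has (fun c => f a c != 0) R)) => [/hasP[c] | /hasPn noc].
  by exists c.
case/eqP: av; rewrite -(grrs_span G) in vU.
rewrite (coord_span (X := in_tuple R) vU) linear_sumr big1 // => i _.
have := noc _ (mem_nth 0 (ltn_ord i)); rewrite negbK => /eqP e.
by rewrite /= formZr e mulr0.
Qed.

(** Real and isotropic reflections treated alike: the reflection of b in c
    moves b by a non-zero multiple of c. *)
Lemma slide_root b c : b \in R -> c \in R -> f c b != 0 ->
  exists2 t : k, t != 0 & b + t *: c \in R.
Proof.
move=> bR cR cb; have [c0|c0] := eqVneq (f c c) 0.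
  have [h|h] := imaginary_root_shift G cR c0 bR cb.
    by exists 1; rewrite ?oner_eq0 ?scale1r.
  by exists (- 1); rewrite ?oppr_eq0 ?oner_eq0 ?scaleN1r.
have [z ez zR] := real_root_int G cR c0 bR.
exists (- z%:~R); last by rewrite scaleNr.
rewrite oppr_eq0; apply: contraNneq cb => z0.
by apply/eqP/(mulfI two0); rewrite ez z0 mul0r mulr0.
Qed.

(** The roots at distance at most two from a in the non-orthogonality graph
    form a union of components. Indeed, along a path a - e - c - d without
    shortcuts, c can be slid along e to a root c + te that still pairs with d
    and now also pairs with a, since (e, d) = 0 and (a, c) = 0. *)
Lemma common_neighbor a b : a \in R -> b \in R -> f a b = 0 ->
  exists c, [/\ c \in R, f a c != 0 & f c b != 0].
Proof.
move=> aR bR ab.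
pose near b := has (fun c => (f a c != 0) && (f c b != 0)) R.
pose R1 := [fset b in R | (f a b != 0) || near b].
have R1E c : c \in R1 = (c \in R) && ((f a c != 0) || near c).
  by rewrite !inE.
case: (boolP (near b)) => [/hasP[c cR /andP[ac cb]]|nb]; first by exists c.
case: irr; exists R1, (R `\` R1); split.
- have [c cR ac] := neighbor_exists aR.
  by apply/fset0Pn; exists c; rewrite R1E cR ac.
- by apply/fset0Pn; exists b; rewrite inE R1E bR ab eqxx (negPf nb).
- by apply/fdisjointP => c c1; rewrite inE c1.
- apply/fsetP => c; rewrite in_fsetU in_fsetD R1E.
  by case: (c \in R); rewrite ?andbF ?andbT ?orbN.
move=> c d; rewrite inE !R1E => /andP[cR hc] /andP[+ dR].
rewrite dR /= negb_or negbK => /andP[/eqP ad nd].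
apply/eqP/negPn/negP => cd; case/negP: nd.
have [ac|ac] := eqVneq (f a c) 0; last first.
  by apply/hasP; exists c; rewrite // ac.
move: hc; rewrite ac eqxx /= => /hasP[e eR /andP[ae ec]].
have [ed|ed] := eqVneq (f e d) 0; last first.
  by apply/hasP; exists e; rewrite // ae.
have [t t0 tR] := slide_root cR eR ec.
apply/hasP; exists (c + t *: e) => //.
by rewrite !formE ac add0r ed mulr0 addr0 cd mulf_neq0.
Qed.

(** An isotropic common neighbour x can be traded for a + tx, of norm
    2t(a, x). *)
Lemma real_common_neighbor a b : a \in R -> f a a = 0 -> b \in R -> f a b = 0 ->
  exists x, [/\ x \in R, f x x != 0, f x a != 0 & f x b != 0].
Proof.
move=> aR aa bR ab; have [x [xR ax xb]] := common_neighbor aR bR ab.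
have [x0|x0] := eqVneq (f x x) 0; last first.
  by exists x; rewrite formC; split.
have xa : f x a != 0 by rewrite formC.
have [t t0 yR] := slide_root aR xR xa.
exists (a + t *: x); split=> //.
- rewrite !formE (formC f x a) aa x0 !mulr0 add0r addr0 -mulr2n -mulr_natl.
  by rewrite !mulf_neq0.
- by rewrite !formE aa add0r mulf_neq0.
by rewrite !formE ab add0r mulf_neq0.
Qed.

(** The last clause expresses that the common neighbour x is determined by a
    and b: it cannot be moved by a symmetry of [R] that fixes both. *)
Definition linked a b : Prop := exists x, [/\ x \in R, f x a != 0, f x b != 0
  & forall theta : {linear V -> V},
      (forall u v, f (theta u) (theta v) = f u v) ->
      (forall c, c \in R -> theta c \in R) ->
      theta a = a -> theta b = b -> theta x = x].

Lemma linked_sym a b : linked a b -> linked b a.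
Proof. by case=> x [xR xa xb fixed]; exists x; split=> // *; apply: fixed. Qed.

Lemma linked_sign a a' b : a' = a \/ a' = - a -> linked a' b -> linked a b.
Proof.
case=> ->// [x [xR xa xb fixed]]; exists x; split=> //.
  by rewrite formNr oppr_eq0 in xa.
by move=> theta iso thR ta tb; apply: fixed; rewrite ?linearN ?ta.
Qed.

(** [rigid_summand] applied to the decomposition a + b = x + (a + b - x). *)
Lemma linked_of_orthogonal_splitting a b x (n : nat) :
  x \in R -> a + b - x \in R -> f x x != 0 -> f x (a + b - x) = 0 ->
  f x x = - (f (a + b - x) (a + b - x) *+ n.+1) ->
  f x a != 0 -> f x b != 0 -> linked a b.
Proof.
move=> xR yR x0 xy norms xa xb; exists x; split=> // theta iso thR ta tb.
apply: (rigid_summand char0 G xR yR (thR _ xR) x0 xy norms (iso _ _)).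
have tab : theta (a + b) = a + b by rewrite linearD ta tb.
rewrite [x + _]addrC subrK -{}tab iso.
by rewrite -[a + b](subrK x) formDr xy add0r.
Qed.

(** Two orthogonal isotropic neighbours of a real root x cannot realize the
    two different pairings allowed by [isotropic_root_string]. Here x - a is
    isotropic and pairs with b, so x - a + b or x - a - b is a root, of norm
    2(x, x) or -2(x, x); its Cartan integer with x would be 3/2 or 1/2. *)
Lemma unequal_isotropic_strings_absurd a b x : a \in R -> b \in R -> x \in R ->
  f a a = 0 -> f b b = 0 -> f a b = 0 -> f x x != 0 -> x - a \in R ->
  2 * f x a = f x x -> f x b = f x x -> False.
Proof.
move=> aR bR xR aa bb ab x0 uR xa xb.
have ax : 2 * f a x = f x x by rewrite formC.
have bu : f b (x - a) = f x x.
  by rewrite !formE (formC f b a) ab subr0 formC.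
have bu0 : f b (x - a) != 0 by rewrite bu.
have uu : f (x - a) (x - a) = 0.
  by rewrite form_sqrB aa -xa; ring.
have ux : 2 * f (x - a) x = f x x.
  by rewrite !formE mulrBr ax; ring.
have bx : f b x = f x x by rewrite formC.
have [yR|yR] := imaginary_root_shift G bR bb uR bu0.
  have yy : f (x - a + b) (x - a + b) = 2 * f x x.
    by rewrite form_sqrD uu bb (formC f _ b) bu; ring.
  have y0 : f (x - a + b) (x - a + b) != 0 by rewrite yy mulf_neq0.
  have [z + _] := real_root_int G yR y0 xR.
  rewrite yy formDl mulrDr ux bx => ez.
  have : 3 = z * 2 by apply: (intr_mulI char0 x0); ring: ez.
  by clear; lia.
have yy : f (x - a - b) (x - a - b) = - (2 * f x x).
  by rewrite form_sqrB uu bb (formC f _ b) bu; ring.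
have y0 : f (x - a - b) (x - a - b) != 0 by rewrite yy oppr_eq0 mulf_neq0.
have [z + _] := real_root_int G yR y0 xR.
rewrite yy formDl formNl mulrDr ux mulrN bx => ez.
have : -1 = z * -2 by apply: (intr_mulI char0 x0); ring: ez.
by clear; lia.
Qed.

(** Normalize signs so that x - a and x - b are roots, where x is a real common
    neighbour. If both are real, their norms and their product are all equal, so
    a = b. If both are isotropic, then x - a pairs with b; the root x - a + b
    cannot occur, since it has the norm of x and that same product with x and
    would be x itself. So a + b - x is a root: it is orthogonal to x and has
    the opposite norm. *)
Lemma isotropic_linked a b : a \in R -> b \in R ->
  f a a = 0 -> f b b = 0 -> f a b = 0 -> b <> a -> b <> - a -> linked a b.
Proof.
move=> aR bR aa bb ab nba nbNa.
have [x [xR x0 xa xb]] := real_common_neighbor aR aa bR ab.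
have [a' [ha' aR' la]] := isotropic_root_string char0 G xR x0 aR aa xa.
have [b' [hb' bR' lb]] := isotropic_root_string char0 G xR x0 bR bb xb.
apply: (linked_sign ha'); apply: linked_sym.
apply: (linked_sign hb'); apply: linked_sym.
have {nba nbNa} nab : a' <> b'.
  move: nba nbNa; case: ha' => ->; case: hb' => -> nba nbNa.
  - by move/esym.
  - by move=> e; apply: nbNa; rewrite e opprK.
  - by move/esym.
  - by move/oppr_inj/esym.
have [{}aR {}aa {}ab0] : [/\ a' \in R, f a' a' = 0 & f a' b = 0].
  by case: ha' => ->; rewrite ?(rootN G) ?formE ?opprK ?ab ?oppr0.
have {ab0 bb bR}[bR bb {}ab] : [/\ b' \in R, f b' b' = 0 & f a' b' = 0].
  by case: hb' => ->; rewrite ?(rootN G) ?formE ?opprK ?ab0 ?oppr0.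
have {xa} xa : f x a' != 0.
  by case: ha' => ->; rewrite ?formNr ?oppr_eq0.
have {xb} xb : f x b' != 0.
  by case: hb' => ->; rewrite ?formNr ?oppr_eq0.
move: a' b' {a b ha' hb'} la lb aR' bR' nab aR aa bR bb ab xa xb.
move=> a b la lb uR vR nab aR aa bR bb ab xa xb.
have ba : f b a = 0 by rewrite formC.
case: la => [la|la]; case: lb => [lb|lb].
- have eb : f x b = f x a by apply: (mulfI two0); rewrite la lb.
  have bu : f b (x - a) != 0 by rewrite !formE ba subr0 formC.
  have uu : f (x - a) (x - a) = 0 by rewrite form_sqrB aa la; ring.
  have [yR|yR] := imaginary_root_shift G bR bb uR bu.
    case: nab; apply/esym/eqP; rewrite -subr_eq0; apply/eqP.
    have : x = x - a + b.
      apply: (eq_of_equal_form_values char0 G xR yR x0).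
        by rewrite form_sqrD uu bb !formE ab eb -la; ring.
      by rewrite !formE eb; ring.
    by move/eqP; rewrite -addrA -subr_eq0 opprD addNKr oppr_eq0 addrC => /eqP.
  have yE : a + b - x = - (x - a - b) by rewrite !opprD !opprK addrC addrA.
  have yy : f (a + b - x) (a + b - x) = - f x x.
    rewrite yE !formE !opprK (formC f a x) (formC f b x) aa bb ab ba eb -la.
    by ring.
  apply: (@linked_of_orthogonal_splitting a b x 0 xR _ x0 _ _ xa xb).
  + by rewrite yE (rootN G).
  + by rewrite !formE eb -la; ring.
  + by rewrite yy mulr1n opprK.
- by case: (unequal_isotropic_strings_absurd aR bR xR aa bb ab x0 uR la lb).
- by case: (unequal_isotropic_strings_absurd bR aR xR bb aa ba x0 vR lb la).
case: nab; apply: oppr_inj; apply: (addrI x).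
have N0 : f (x - a) (x - a) = - f x x by rewrite form_sqrB aa la; ring.
apply: (eq_of_equal_form_values char0 G uR vR).
- by rewrite N0 oppr_eq0.
- by rewrite N0 form_sqrB bb lb; ring.
by rewrite N0 !formE ab (formC f a x) la lb; ring.
Qed.

(** Integrality with respect to the root 2a is twice as strong as with respect
    to a. *)
Lemma real_odd_product a x : a \in R -> 2 *: a \in R -> f a a != 0 -> x \in R ->
  exists z : int, f a x = z%:~R * f a a.
Proof.
move=> aR a2R a0 xR.
have n2 : f (2 *: a) (2 *: a) = 2 * (2 * f a a) by rewrite !formE.
have n20 : f (2 *: a) (2 *: a) != 0 by rewrite n2 !mulf_neq0.
have [z + _] := real_root_int G a2R n20 xR.
rewrite n2 !formE => e; exists z; apply/(mulfI two0)/(mulfI two0).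
by rewrite e; ring.
Qed.

(** The Cartan integers of a and x are 2z and p with 0 < 2zp <= 4. The case
    zp = 2 makes x proportional to a, so zp = 1: these are the Cartan integers
    of type B2, with a short. *)
Lemma real_odd_neighbor a x : a \in R -> 2 *: a \in R -> f a a != 0 ->
  x \in R -> f x x != 0 -> f a x != 0 -> (forall c, x <> c *: a) ->
  f x x = 2 * f a a /\ (f a x = f a a \/ f a x = - f a a).
Proof.
move=> aR a2R a0 xR x0 ax nx.
have [z ez] := real_odd_product aR a2R a0 xR.
have [p ep _] := real_root_int G xR x0 aR; rewrite formC in ep.
have ez2 : 2 * f a x = (2 * z)%:~R * f a a by rewrite ez; ring.
have := real_root_pair_bound char0 G aR xR a0 x0 ez2 ep.
have z0 : z != 0 by apply: contraNneq ax => z0; rewrite ez z0 mul0r.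
have p0 : p != 0.
  apply: contraNneq ax => p0; apply/eqP/(mulfI two0).
  by rewrite ep p0 mul0r mulr0.
move=> /(small_string_products _ _ z0 p0) {z0 p0 ez2}.
have xE : p%:~R * f x x = 2 * z%:~R * f a a by rewrite -ep ez; ring.
have mem c (s : int) : c \in R -> s = 1 \/ s = -1 -> s%:~R *: c \in R.
  by move=> cR [] ->; rewrite ?scale1r ?scaleN1r ?(rootN G).
case=> s s1; have ss : s%:~R * s%:~R = 1 :> k.
  by case: s1 => ->; rewrite ?mulrNN mulr1.
have s0 : s%:~R != 0 :> k.
  by apply: contra_eq_neq ss => ->; rewrite mul0r eq_sym oner_eq0.
case=> [[zE pE]|[zE pE]|[zE pE]]; rewrite {}zE {}pE in ez xE.
- split; first by apply: (mulfI s0); rewrite xE; ring.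
  by rewrite ez; case: s1 => ->; [left; rewrite mul1r | right; rewrite mulN1r].
- have xa : f x x = f a a.
    apply/(mulfI s0)/(mulfI two0).
    by transitivity ((2 * s)%:~R * f x x); [ring | rewrite xE; ring].
  case: (nx s%:~R).
  apply: (eq_of_equal_form_values char0 G xR (mem _ _ aR s1) x0).
    by rewrite !formE mulrA ss mul1r.
  by rewrite formZr formC ez mulrA ss mul1r.
have xa : f x x = 2 * 2 * f a a by apply: (mulfI s0); rewrite xE; ring.
case: (nx (s%:~R * 2)); rewrite -scalerA.
apply: (eq_of_equal_form_values char0 G xR (mem _ _ a2R s1) x0).
  rewrite xa !formE; transitivity (s%:~R * s%:~R * (2 * 2 * f a a)).
    by ring.
  by rewrite ss mul1r.
rewrite !formZr formC ez xa; transitivity (s%:~R * s%:~R * (2 * 2 * f a a)).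
  by ring.
by rewrite ss mul1r.
Qed.

(** For an odd real root, [real_odd_product] excludes the first alternative of
    [isotropic_root_string]. The sign is put on a rather than on x so that two
    odd real roots can be compared with the same x. *)
Lemma real_odd_isotropic_string a x :
  a \in R -> 2 *: a \in R -> f a a != 0 -> x \in R -> f x x = 0 -> f a x != 0 ->
  exists a', [/\ a' = a \/ a' = - a, a' \in R, f a' a' = f a a, f a' x = f a a
    & a' - x \in R].
Proof.
move=> aR a2R a0 xR xx ax.
have [x' [hx' uR hax]] := isotropic_root_string char0 G aR a0 xR xx ax.
have x'R : x' \in R by case: hx' => ->; rewrite ?(rootN G).
have ax' : f a x' = f a a.
  case: hax => // e; have [z ez] := real_odd_product aR a2R a0 x'R.
  have : 2 * z = 1 :> int.
    apply: (intr_mulI char0 a0); rewrite mul1r.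
    by transitivity (2 * f a x'); [rewrite ez; ring | rewrite e].
  by clear; lia.
case: hx' => x'E; rewrite {}x'E in uR ax'.
  by exists a; split=> //; left.
exists (- a); split; first by right.
- exact: (rootN G).
- by rewrite formNl formNr opprK.
- by rewrite formNl -formNr.
- by rewrite -opprD (rootN G) // -[x]opprK.
Qed.

(** Whatever the common neighbour x is, it equals a + b up to the signs of a
    and b. If x is real, the norms and the product of x - a and b are all
    equal. If x is isotropic, then a - x has norm -(a, a) and product -(b, b) with b, and
    symmetrically for b - x; the two Cartan bounds force (b, b) = -(a, a), and
    the norms and the product of a - x and -b are again all equal, so
    [eq_of_equal_form_values] applies in both cases. *)
Lemma real_odd_linked a b : a \in R -> 2 *: a \in R -> f a a != 0 ->
  b \in R -> 2 *: b \in R -> f b b != 0 -> f a b = 0 -> linked a b.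
Proof.
move=> aR a2R a0 bR b2R b0 ab.
have [x [xR ax xb]] := common_neighbor aR bR ab.
suff [a' [b' [ha' hb' xE]]] : exists a' b',
  [/\ a' = a \/ a' = - a, b' = b \/ b' = - b & x = a' + b'].
  exists x; split=> //; first by rewrite formC.
  move=> theta iso thR ta tb; rewrite {1}xE linearD.
  by rewrite xE; case: ha' => ->; case: hb' => ->; rewrite ?linearN ?ta ?tb.
have bx : f b x != 0 by rewrite formC.
have signs a' b' : a' = a \/ a' = - a -> b' = b \/ b' = - b -> f a' b' = 0.
  by case=> -> [] ->; rewrite ?formE ab ?oppr0 ?oppr0.
have [x0|x0] := eqVneq (f x x) 0.
  have [a' [ha' a'R aa' ax' uR]] :=
    real_odd_isotropic_string aR a2R a0 xR x0 ax.
  have [b' [hb' b'R bb' bx' vR]] :=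
    real_odd_isotropic_string bR b2R b0 xR x0 bx.
  have ab' := signs _ _ ha' hb'.
  have uu : f (a' - x) (a' - x) = - f a a by rewrite form_sqrB aa' ax' x0; ring.
  have vv : f (b' - x) (b' - x) = - f b b by rewrite form_sqrB bb' bx' x0; ring.
  have u0 : f (a' - x) (a' - x) != 0 by rewrite uu oppr_eq0.
  have v0 : f (b' - x) (b' - x) != 0 by rewrite vv oppr_eq0.
  have ub : f (a' - x) b' = - f b b by rewrite !formE ab' (formC f x) bx'; ring.
  have va : f (b' - x) a' = - f a a.
    by rewrite !formE (formC f b') ab' (formC f x) ax'; ring.
  have a'0 : f a' a' != 0 by rewrite aa'.
  have b'0 : f b' b' != 0 by rewrite bb'.
  have [p ep _] := real_root_int G uR u0 b'R.
  have [q eq _] := real_root_int G vR v0 a'R.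
  have ep' : 2 * f (a' - x) b' = (-2)%:~R * f b' b' by rewrite ub bb'; ring.
  have eq' : 2 * f (b' - x) a' = (-2)%:~R * f a' a' by rewrite va aa'; ring.
  have := real_root_pair_bound char0 G uR b'R u0 b'0 ep ep'.
  have := real_root_pair_bound char0 G vR a'R v0 a'0 eq eq'.
  rewrite ub uu in ep; rewrite va vv in eq => hq hp.
  have {}ep : p%:~R * f a a = 2 * f b b.
    by apply: oppr_inj; rewrite -mulrN -ep; ring.
  have {}eq : q%:~R * f b b = 2 * f a a.
    by apply: oppr_inj; rewrite -mulrN -eq; ring.
  have pq : p * q = 4.
    apply: (intr_mulI char0 b0).
    transitivity (p%:~R * (q%:~R * f b b)); first by ring.
    rewrite eq; transitivity (2 * (p%:~R * f a a)); first by ring.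
    by rewrite ep; ring.
  have p2 : p = -2 by move: hp hq pq; clear; nia.
  have AB : f a a = - f b b.
    by apply: (mulfI two0); rewrite mulrN -ep p2; ring.
  exists a', b'; split=> //.
  have uE : a' - x = - b'.
    apply: (eq_of_equal_form_values char0 G uR (rootN G b'R) u0).
      by rewrite uu formNl formNr opprK bb' AB opprK.
    by rewrite formNr ub uu AB.
  by rewrite -[b']opprK -uE opprB addrC subrK.
have [Xa ha] : f x x = 2 * f a a /\ (f a x = f a a \/ f a x = - f a a).
  apply: real_odd_neighbor => // c xE; case/eqP: bx.
  by rewrite xE formZr formC ab mulr0.
have [Xb hb] : f x x = 2 * f b b /\ (f b x = f b b \/ f b x = - f b b).
  apply: real_odd_neighbor => // c xE; case/eqP: ax.
  by rewrite xE formZr ab mulr0.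
have AB : f b b = f a a by apply: (mulfI two0); rewrite -Xa.
have [a' [ha' a'R aa' ax']] : exists a',
    [/\ a' = a \/ a' = - a, a' \in R, f a' a' = f a a & f x a' = f a a].
  case: ha => h; [exists a | exists (- a)]; split; rewrite ?(rootN G) //.
  - by left.
  - by rewrite formC.
  - by right.
  - by rewrite formNl formNr opprK.
  - by rewrite formNr formC h opprK.
have [b' [hb' b'R bb' bx']] : exists b',
    [/\ b' = b \/ b' = - b, b' \in R, f b' b' = f a a & f x b' = f a a].
  case: hb => h; [exists b | exists (- b)]; split; rewrite ?(rootN G) //.
  - by left.
  - by rewrite formC h.
  - by right.
  - by rewrite formNl formNr opprK.
  - by rewrite formNr formC h opprK.
exists a', b'; split=> //.
have yR : x - a' \in R.
  rewrite -opprB (rootN G) // -[x]scale1r.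
  by apply: (reflect_mem char0 G (z := 1)); rewrite ?mul1r ?ax'.
have -> : b' = x - a'; last by rewrite addrC subrK.
apply: (eq_of_equal_form_values char0 G b'R yR); rewrite bb' //.
  by rewrite form_sqrB aa' ax' Xa; ring.
by rewrite !formE (formC f b' x) bx' (formC f b') (signs _ _ ha' hb') subr0.
Qed.

(** By [real_odd_neighbor], (x, x) = 2(a, a). If x - b were real it would have
    norm -2(a, a) and pair with a, against [opposite_norm_orth]. So x - b is
    isotropic, pairs with a, and y = a - (x - b) is a root of norm -(a, a)
    orthogonal to x. *)
Lemma real_odd_isotropic_linked a b : a \in R -> 2 *: a \in R -> f a a != 0 ->
  b \in R -> f b b = 0 -> f a b = 0 -> linked a b.
Proof.
move=> aR a2R a0 bR bb ab.
have ba : f b a = 0 by rewrite formC.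
have [x [xR x0 xb xa]] := real_common_neighbor bR bb aR ba.
have [X ha] : f x x = 2 * f a a /\ (f a x = f a a \/ f a x = - f a a).
  apply: real_odd_neighbor => //; first by rewrite formC.
  by move=> c xE; case/eqP: xb; rewrite xE formZl ab mulr0.
have [a' [ha' a'R aa' ax']] : exists a',
    [/\ a' = a \/ a' = - a, a' \in R, f a' a' = f a a & f a' x = f a a].
  case: ha => h; [exists a | exists (- a)]; split; rewrite ?(rootN G) //.
  - by left.
  - by right.
  - by rewrite formNl formNr opprK.
  - by rewrite formNl h opprK.
have [b' [hb' yR hbx]] := isotropic_root_string char0 G xR x0 bR bb xb.
apply: (linked_sign ha'); apply: linked_sym.
apply: (linked_sign hb'); apply: linked_sym.
have [b'R bb' ab'] : [/\ b' \in R, f b' b' = 0 & f a' b' = 0].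
  case: hb' => ->; case: ha' => ->;
    by rewrite ?(rootN G) ?formE ?opprK ?bb ?ab ?oppr0.
have a'0 : f a' a' != 0 by rewrite aa'.
have xa' : f x a' = f a a by rewrite formC.
have [xb'|xb'] := hbx; last first.
  have yy : f (x - b') (x - b') = - (f a' a' *+ 2).
    by rewrite form_sqrB bb' xb' X aa'; ring.
  have y0 : f (x - b') (x - b') != 0.
    by rewrite yy oppr_eq0 -mulr_natl mulf_neq0.
  have /eqP := opposite_norm_orth char0 G yR a'R y0 yy.
  by rewrite !formE xa' (formC f b') ab' subr0 (negPf a0).
have {}xb' : f x b' = f a a by apply: (mulfI two0); rewrite xb'.
have uu : f (x - b') (x - b') = 0 by rewrite form_sqrB bb' xb' X; ring.
have au : f a' (x - b') = f a a by rewrite !formE ax' ab' subr0.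
have au0 : f a' (x - b') != 0 by rewrite au.
have [u' [hu' wR hw]] := isotropic_root_string char0 G a'R a'0 yR uu au0.
have three0 : (3 : k) != 0 := natr_neq0 char0 2.
have u'E : u' = x - b'.
  case: hu' => // u'E; case/eqP: a0; rewrite {}u'E formNr au aa' in hw.
  case: hw => /eqP; rewrite -subr_eq0.
    have -> : 2 * - f a a - f a a = - (3 * f a a) by ring.
    by rewrite oppr_eq0 mulf_eq0 (negPf three0) => /eqP.
  by rewrite -opprD oppr_eq0 -mulr2n -mulr_natl mulf_eq0 (negPf two0) => /eqP.
have yE : a' + b' - x = a' - u' by rewrite u'E opprB addrA.
have yy : f (a' - u') (a' - u') = - f a a.
  by rewrite form_sqrB u'E uu au aa'; ring.
apply: (@linked_of_orthogonal_splitting a' b' x 1); rewrite ?yE //.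
- by rewrite u'E !formE xa' xb' X; ring.
- by rewrite yy X; ring.
- by rewrite xa'.
- by rewrite xb'.
Qed.

Lemma odd_roots_linked a b : odd_root f R a -> odd_root f R b ->
  f a b = 0 -> b <> a -> b <> - a -> linked a b.
Proof.
rewrite /odd_root /imaginary_root /real_root.
have half c : f (2 *: c) (2 *: c) != 0 -> f c c != 0.
  by apply: contraNneq => c0; rewrite !formE c0 !mulr0.
move=> /andP[aR ha] /andP[bR hb] ab nba nbNa.
have ba : f b a = 0 by rewrite formC.
case/orP: ha => [/andP[_ /eqP a0]|/andP[a2R /half a0]];
  case/orP: hb => [/andP[_ /eqP b0]|/andP[b2R /half b0]].
- exact: isotropic_linked.
- by apply: linked_sym; apply: real_odd_isotropic_linked.
- exact: real_odd_isotropic_linked.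
- exact: real_odd_linked.
Qed.

End CommonNeighbors.

(** * The roots fixed by an isometry *)

Section FixedRoots.

Set Implicit Arguments.
Unset Strict Implicit.

Variables (k : fieldType) (char0 : [pchar k] =i pred0).
Variables (V : vectType k) (f : {symmetric V}).
Variables (U : {vspace V}) (R : {fset V}) (G : grrs_in f U R).
Hypothesis irr : ~ reducible_roots f R.
Variables (theta : {linear V -> V}).
Hypothesis theta_form : forall u v : V, f (theta u) (theta v) = f u v.
Hypothesis theta_R : forall c, c \in R -> theta c \in R.

Local Notation S := (fixed_roots theta R).
Variables (T : {fset V}) (T_closed : odd_closed f R S T).
Hypothesis T_smallest : forall T', odd_closed f R S T' -> T `<=` T'.

Lemma mem_fixed_roots a : (a \in S) = (a \in R) && (theta a == a).
Proof. by rewrite !inE. Qed.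

Lemma fixed_rootsN a : a \in S -> - a \in S.
Proof.
rewrite !mem_fixed_roots => /andP[aR /eqP ta].
by rewrite (rootN G) // linearN ta eqxx.
Qed.

Lemma odd_root_mem a : odd_root f R a -> a \in R.
Proof. by case/andP. Qed.

Lemma odd_rootN a : odd_root f R a -> odd_root f R (- a).
Proof.
rewrite /odd_root /imaginary_root /real_root scalerN !formNl !formNr !opprK.
move=> /andP[aR]; rewrite aR (rootN G aR) /= => /orP[->//|/andP[a2R ->]].
by rewrite (rootN G a2R) orbT.
Qed.

Lemma fixed_odd_roots_linked a b : a \in S -> odd_root f R a ->
  b \in S -> odd_root f R b -> f a b = 0 -> b <> a -> b <> - a ->
  exists x, [/\ x \in S, f a x != 0 & f x b != 0].
Proof.
rewrite !mem_fixed_roots => /andP[aR /eqP ta] oa /andP[bR /eqP tb] ob ab n1 n2.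
have [x [xR xa xb fixed]] := odd_roots_linked char0 G irr oa ob ab n1 n2.
by exists x; rewrite formC mem_fixed_roots xR fixed ?eqxx.
Qed.

(** Every odd root of S other than a and -a pairs with a or shares a neighbour
    in S with a, which is impossible when a is isolated. *)
Lemma isolated_odd_root a : a \in S -> odd_root f R a ->
  (forall c, c \in S -> f a c = 0) -> f a a = 0 /\ T = [fset a; - a].
Proof.
move=> aS oa iso; split; first exact: iso.
have [sTS oddT _] := T_closed.
apply/eqP; rewrite eqEfsubset; apply/andP; split.
  apply: T_smallest; split.
  - by apply/fsubsetP => b /fset2P[] ->; rewrite ?fixed_rootsN.
  - move=> b bS ob; apply/fset2P.
    have [->|/eqP n1] := eqVneq b a; first by left.
    have [->|/eqP n2] := eqVneq b (- a); first by right.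
    have [x [xS ax _]] := fixed_odd_roots_linked aS oa bS ob (iso b bS) n1 n2.
    by rewrite iso ?eqxx in ax.
  - by move=> c b /fset2P[] -> bS; rewrite ?formNl iso ?oppr0 ?eqxx.
apply/fsubsetP => b /fset2P[] ->; first exact: oddT.
by apply: oddT; [apply: fixed_rootsN | apply: odd_rootN].
Qed.

Hypothesis not_isolated : forall a, a \in S -> odd_root f R a ->
  exists2 c, c \in S & f a c != 0.

(** All odd roots of S lie in one component of [T]. The root -a, which may be
    orthogonal to a, shares with a any neighbour of a. *)
Lemma odd_roots_same_side (P : pred V) a b :
  (forall c d, P c -> c \in T -> d \in T -> f c d != 0 -> P d) ->
  a \in S -> odd_root f R a -> b \in S -> odd_root f R b -> P a -> P b.
Proof.
move=> clP aS oa bS ob Pa; have [sTS oddT clT] := T_closed.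
have aT := oddT _ aS oa; have bT := oddT _ bS ob.
have [ab|ab] := eqVneq (f a b) 0; last exact: clP ab.
have via x : x \in S -> f a x != 0 -> f x b != 0 -> P b.
  move=> xS ax xb; have xT := clT _ _ aT xS ax.
  by apply: (clP x b) => //; apply: (clP a x).
have [->//|/eqP n1] := eqVneq b a.
have [e|/eqP n2] := eqVneq b (- a).
  have [c cS ac] := not_isolated aS oa.
  by apply: (via c) => //; rewrite e formNr oppr_eq0 formC.
have [x [xS ax xb]] := fixed_odd_roots_linked aS oa bS ob ab n1 n2.
by apply: (via x).
Qed.

Lemma fixed_odd_root_exists : T != fset0 -> exists2 a, a \in S & odd_root f R a.
Proof.
move=> T0; case: (boolP (has (odd_root f R) S)) => [/hasP[a aS oa]|/hasPn none].
  by exists a.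
case/negP: T0; rewrite -fsubset0; apply: T_smallest; split=> //.
by move=> a aS oa; have := none a aS; rewrite oa.
Qed.

(** The side of a splitting of [T] that contains one odd root contains them
    all, hence is odd-closed and equal to [T] by minimality. *)
Lemma odd_component_irreducible : ~ reducible_roots f T.
Proof.
case=> R1 [R2 [R10 R20 dis TE orth]]; have [sTS oddT clT] := T_closed.
have [a0 a0T] : exists a, a \in T.
  by case/fset0Pn: R10 => a a1; exists a; rewrite TE in_fsetU a1.
have T0 : T != fset0 by apply/fset0Pn; exists a0.
have [a aS oa] := fixed_odd_root_exists T0.
have aT := oddT _ aS oa.
have closed_side (Q1 Q2 : {fset V}) : [disjoint Q1 & Q2] -> T = Q1 `|` Q2 ->
    (forall c d, c \in Q1 -> d \in Q2 -> f c d = 0) -> a \in Q1 -> Q2 = fset0.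
  move=> disQ TQ orthQ aQ.
  have stay c d : c \in Q1 -> c \in T -> d \in T -> f c d != 0 -> d \in Q1.
    move=> cQ _; rewrite TQ in_fsetU => /orP[//|dQ].
    by rewrite (orthQ c d) ?eqxx.
  have sub : T `<=` Q1.
    apply: T_smallest; split.
    - by apply: fsubset_trans sTS; rewrite TQ fsubsetUl.
    - move=> b bS ob; exact: (@odd_roots_same_side (mem Q1) a b).
    - move=> c d cQ dS cd; have cT : c \in T by rewrite TQ in_fsetU cQ.
      by apply: (stay c d) => //; apply: clT cd.
  apply/eqP; rewrite -fsubset0; apply/fsubsetP => d dQ.
  have : d \in Q1 by apply: (fsubsetP sub); rewrite TQ in_fsetU dQ orbT.
  by move/(fdisjointP disQ); rewrite dQ.
move: (aT); rewrite TE in_fsetU => /orP[a1|a2].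
  by move: R20; rewrite (closed_side R1 R2) ?eqxx.
move: R10; rewrite (closed_side R2 R1) ?eqxx //.
- by rewrite fdisjoint_sym.
- by rewrite fsetUC.
- by move=> c d c2 d1; rewrite formC orth.
Qed.

Lemma odd_componentN a : a \in T -> - a \in T.
Proof.
move=> aT; have [sTS oddT clT] := T_closed.
have aS := fsubsetP sTS _ aT; have NaS := fixed_rootsN aS.
have [a0|a0] := eqVneq (f a a) 0; last first.
  by apply: clT aT NaS _; rewrite formNr oppr_eq0.
apply: oddT NaS (odd_rootN _).
move: aS; rewrite mem_fixed_roots /odd_root /imaginary_root a0 eqxx.
by case/andP=> ->.
Qed.

(** Reflections of [R] in roots of [T] preserve [T]. *)
Lemma odd_component_translate a b c : a \in T -> b \in T -> f a b != 0 ->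
  b + c *: a \in R -> f a (b + c *: a) != 0 -> b + c *: a \in T.
Proof.
move=> aT bT ab dR ad; have [sTS _ clT] := T_closed.
move: (fsubsetP sTS _ aT) (fsubsetP sTS _ bT); rewrite !mem_fixed_roots.
move=> /andP[_ /eqP ta] /andP[_ /eqP tb].
apply: clT aT _ ad.
by rewrite mem_fixed_roots dR linearD linearZ_LR /= ta tb eqxx.
Qed.

Lemma odd_component_grrs : T != fset0 -> grrs_in f <<T>>%VS T.
Proof.
move=> T0; have [sTS oddT clT] := T_closed.
have TR a : a \in T -> a \in R.
  by move=> /(fsubsetP sTS); rewrite mem_fixed_roots => /andP[].
split=> //.
- by apply/negP => /TR z; move: (grrs_nonzero G); rewrite z.
- move=> a aT; have [a0|a0] := eqVneq (f a a) 0; last first.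
    by exists a => //; apply: memv_span.
  have aS := fsubsetP sTS _ aT.
  have oa : odd_root f R a by rewrite /odd_root /imaginary_root a0 eqxx TR.
  have [c cS ac] := not_isolated aS oa.
  by exists c => //; apply/memv_span/(clT a c).
- move=> a b /andP[aT a0] bT.
  have ra : real_root f R a by rewrite /real_root TR.
  have [[z ez] rR] := grrs_real G ra (TR _ bT); split; first by exists z.
  rewrite /reflection -scaleNr in rR *.
  have [ab|ab] := eqVneq (f a b) 0.
    by rewrite /kcoef ab mulr0 mul0r oppr0 scale0r addr0.
  apply: odd_component_translate => //.
  rewrite formDr formZr /kcoef mulNr mulfVK //.
  have -> : f a b - 2 * f a b = - f a b by ring.
  by rewrite oppr_eq0.
- move=> a /andP[aT /eqP a0].
  have ia : imaginary_root f R a by rewrite /imaginary_root TR // a0 eqxx.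
  have [r [/bij_inj r_inj rE]] := grrs_imaginary G ia.
  pose up (b : T) : R := [` TR _ (fsvalP b)].
  have upT (b : T) : val (r (up b)) \in T.
    have [e1 e2] := rE (up b).
    have [ab|ab] := eqVneq (f a (val b)) 0.
      by rewrite e1 //; exact: fsvalP.
    have drR : val (r (up b)) \in R by exact: fsvalP.
    have [s e] : exists s : k, val (r (up b)) = val b + s *: a.
      have [e|e] := e2 ab; [exists 1 | exists (-1)].
        by rewrite scale1r.
      by rewrite scaleN1r.
    rewrite e in drR; rewrite e; apply: odd_component_translate => //.
      exact: fsvalP.
    by rewrite formDr formZr a0 mulr0 addr0.
  (* An injective self-map of the finite set T is bijective. *)
  exists (fun b => [` upT b]); split; last by move=> b; apply: (rE (up b)).
  apply: injF_bij => b c /(congr1 val) /= /val_inj /r_inj /(congr1 val) /= e.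
  exact: val_inj.
apply/fsetP => a; apply/idP/imfsetP => /= [aT|[b bT ->]].
  by exists (- a); rewrite ?opprK // odd_componentN.
exact: odd_componentN.
Qed.

Lemma odd_component_odd_root a : a \in S -> odd_root f R a -> odd_root f T a.
Proof.
move=> aS oa; have [sTS oddT clT] := T_closed; have aT := oddT _ aS oa.
move: oa; rewrite /odd_root /imaginary_root /real_root aT.
case/andP=> aR; rewrite aR /= => /orP[->//|/andP[a2R a2]].
rewrite a2 andbT (_ : 2 *: a \in T) ?orbT //.
apply: clT aT _ _.
  move: aS; rewrite !mem_fixed_roots a2R linearZ_LR => /andP[_ /eqP /= ->].
  by rewrite eqxx.
by apply: contraNneq a2 => e; rewrite formZl e mulr0.
Qed.

End FixedRoots.

Theorem theorem1p1 (k : closedFieldType) (char0 : [pchar k] =i pred0)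
    (V : vectType k) (f : {symmetric V}) (R : {fset V})
    (irrR : irreducible_grrs_in f fullv R)
    (theta : {linear V -> V}) (theta_bij : bijective theta)
    (theta_form : forall u v : V, f (theta u) (theta v) = f u v)
    (theta_R : [fset theta a | a in R] = R)
    (T : {fset V})
    (T_def : smallest_odd_closed f R (fixed_roots theta R) T) :
  [\/ T = fset0,
      exists2 a : V, imaginary_root f R a & T = [fset a; - a]
    | irreducible_grrs_in f <<T>>%VS T /\ exists a : V, odd_root f T a].
Proof.
have [[G irr] [T_closed T_smallest]] := (irrR, T_def).
have thR c : c \in R -> theta c \in R.
  by move=> cR; rewrite -[X in _ \in X]theta_R; apply/imfsetP; exists c.
have [->|T0] := eqVneq T fset0; first by constructor 1.
have [a aS oa] := fixed_odd_root_exists T_smallest T0.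
pose isolated b :=
  odd_root f R b && all (fun c => f b c == 0) (fixed_roots theta R).
case: (boolP (has isolated (fixed_roots theta R))).
  case/hasP=> b bS /andP[ob /allP iso].
  have [|b0 TE] :=
    isolated_odd_root char0 G irr theta_form thR T_closed T_smallest bS ob.
    by move=> c cS; apply/eqP/iso.
  constructor 2; exists b => //.
  by rewrite /imaginary_root (odd_root_mem ob) b0 eqxx.
move=> /hasPn none.
have not_isolated b : b \in fixed_roots theta R -> odd_root f R b ->
    exists2 c, c \in fixed_roots theta R & f b c != 0.
  move=> bS ob; have := none b bS; rewrite /isolated ob /= -has_predC.
  by case/hasP=> c cS bc; exists c.
constructor 3; split; first split.
- exact: (odd_component_grrs G T_closed not_isolated).
- exact: (odd_component_irreducible char0 G irr theta_form thR T_closed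
            T_smallest).
by exists a; apply: (odd_component_odd_root T_closed).
Qed.
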